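(* Consider a symmetric two-player game with uncertainty (that is, $u_1=u_2$ and $\Theta_1=\Theta_2$, a closed bounded real interval of non-zero length) in which, for $i=1,2$ and $j=3-i$, the reward $u_i$ is strictly monotonic in $x_j$, and the best response $r_i(x_j,\theta_i)$ is single-valued and strictly monotonic in $x_j$ and in $\theta_i$. Then, in the attitude game, pessimism cannot be a dominant attitude for any of the two players.
   Context: Setting. For $i=1,2$ and $j=3-i$, player $i$ chooses a strategy $x_i$ in a closed bounded interval $X_{i,o}\subset\mathbb R$, has type $\theta_i\in\Theta_i$, and has real-valued reward $u_i(x,\theta_i)$, $x=(x_1,x_2)$, continuous in $(x,\theta_i)$, with a unique maximizer over $x_i\in X_{i,o}$ for every $(x_j,\theta_i)$; the full information game has at least one pure Nash equilibrium. Player $i$ knows $\theta_i$ but only knows that $\theta_j\in\Theta_j$; this is common knowledge. In the symmetric game, $u_1=u_2$ means that both players have the same reward as a function of (own strategy, opponent's strategy, own type). The best response $r_i(x_j,\theta_i)$ is the maximizer of $u_i(x,\theta_i)$ over $x_i\in X_{i,o}$ for given $x_j$ and $\theta_i$. Attitudes. Player $i$ has attitude $\pi_i$ ($1$ = optimism, $0$ = pessimism). If player $i$ believes $x_j\in X_j$, she maximizes over $x_i\in X_{i,o}$ the quantity $$f_i(x_i,X_j,\theta_i,\pi_i)=\pi_i\max_{x_j\in X_j}u_i(x,\theta_i)+(1-\pi_i)\min_{x_j\in X_j}u_i(x,\theta_i).$$ Let $r_i(X_j,\theta_i;\pi_i)$ be the set of maximizers and $\psi_i(X_j;\pi_i)=\bigcup_{\theta_i\in\Theta_i}r_i(X_j,\theta_i;\pi_i)$.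 A pair of sets $(X_1,X_2)$ is an uncertainty equilibrium for attitudes $\pi=(\pi_1,\pi_2)$ if $X_i=\psi_i(X_j;\pi_i)$ for $i=1,2$, $j=3-i$. If the uncertainty equilibrium is unique, player $i$ plays $x_i\in r_i(X_j,\theta_i;\pi_i)$; if this is a single point $x_i(\theta_i,\pi)$, the actual reward of player $i$ is $U_i(\pi)=u_i(x_i(\theta_i,\pi),x_j(\theta_j,\pi),\theta_i)$. The attitude game presupposes that these rewards are well defined. Attitude game. In the first stage the players choose $(\pi_1,\pi_2)\in\{0,1\}^2$; in the second stage they play the game with these attitudes and get the rewards $U_i(\pi)$. An attitude $\pi_i^*$ of player $i$ (of type $\theta_i$) is dominant if for every $\pi_j\in\{0,1\}$ and every $\theta_j\in\Theta_j$ one has $U_i(\pi_i^*,\pi_j)\ge U_i(\pi_i,\pi_j)$ for all $\pi_i\in\{0,1\}$ (where $U_i(\pi_i,\pi_j)$ denotes the reward of player $i$ when she has attitude $\pi_i$ and the opponent $\pi_j$). *)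

(* Defs.v *)
From HB Require Import structures.
From mathcomp Require Import all_boot all_order all_algebra.
From mathcomp Require Import all_classical all_reals all_analysis.
Set Implicit Arguments.
Unset Strict Implicit.
Unset Printing Implicit Defensive.
Import Order.TTheory GRing.Theory Num.Theory.
Import numFieldNormedType.Exports.
Local Open Scope classical_set_scope.
Local Open Scope ring_scope.

(** The two players are indexed by [bool]; the opponent of [i] is [~~ i].
    [reward G i x y t] is the reward of player [i] with own strategy [x],
    opponent's strategy [y] and own type [t]: the own strategy comes first for
    both players.  Rewards are total functions, but only their values on
    [strategies G i], [strategies G (~~ i)] and [types G i] are ever used. *)
Record game (R : realType) := Game {
  strat_lo : bool -> R;
  strat_hi : bool -> R;
  types : bool -> set R;
  reward : bool -> R -> R -> R -> R
}.

Definition strategies (R : realType) (G : game R) (i : bool) : set R :=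
  `[strat_lo G i, strat_hi G i]%classic.

Definition maximizers (R : realType) (D : set R) (f : R -> R) : set R :=
  [set x | D x /\ forall z, D z -> f z <= f x].

Definition strictly_monotonic_on (R : realType) (D : set R) (f : R -> R) : Prop :=
  {in D &, {homo f : x y / x < y}} \/ {in D &, {homo f : x y /~ x < y}}.

Definition best_responses (R : realType) (G : game R) (i : bool) (y t : R) : set R :=
  maximizers (strategies G i) (fun x => reward G i x y t).

(** Meaningful when [best_responses G i y t] is a singleton. *)
Definition best_response (R : realType) (G : game R) (i : bool) (y t : R) : R :=
  get (best_responses G i y t).

Definition nash_equilibrium (R : realType) (G : game R) (t x : bool -> R) : Prop :=
  forall i, best_responses G i (x (~~ i)) (t i) (x i).

Record game_with_uncertainty (R : realType) (G : game R) : Prop := {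
  strat_le : forall i, strat_lo G i <= strat_hi G i;
  reward_continuous : forall i,
    {within strategies G i `*` strategies G (~~ i) `*` types G i,
      continuous (fun p : R * R * R => reward G i p.1.1 p.1.2 p.2)};
  best_response_unique : forall i y t,
    strategies G (~~ i) y -> types G i t ->
    exists! x, best_responses G i y t x;
  nash_exists : forall t : bool -> R, (forall i, types G i (t i)) ->
    exists x, nash_equilibrium G t x
}.

(** Having the same reward function entails having the same strategy set. *)
Record symmetric_game (R : realType) (G : game R) : Prop := {
  sym_strategies : strategies G true = strategies G false;
  sym_types : types G true = types G false;
  sym_reward : forall x y t,
    strategies G true x -> strategies G true y -> types G true t ->
    reward G true x y t = reward G false x y t
}.

(** [a] is the weight of optimism, [a = 1], against pessimism, [a = 0].
    [sup] and [inf] are attained when [Y] is nonempty and compact and the reward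
    is continuous, which is how this definition is used below. *)
Definition attitude_value (R : realType) (G : game R) (i : bool)
    (x : R) (Y : set R) (t a : R) : R :=
  a * sup [set reward G i x y t | y in Y]
  + (1 - a) * inf [set reward G i x y t | y in Y].

Definition attitude_responses (R : realType) (G : game R) (i : bool)
    (Y : set R) (t a : R) : set R :=
  maximizers (strategies G i) (fun x => attitude_value G i x Y t a).

Definition psi (R : realType) (G : game R) (i : bool) (Y : set R) (a : R) : set R :=
  \bigcup_(t in types G i) attitude_responses G i Y t a.

(** Nonemptiness and compactness make the maxima and minima over the belief
    sets exist; [X i] is included in [strategies G i] because [psi] is. *)
Definition uncertainty_equilibrium (R : realType) (G : game R)
    (a : bool -> R) (X : bool -> set R) : Prop :=
  forall i, [/\ X i !=set0, compact (X i) & X i = psi G i (X (~~ i)) (a i)].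

(** In the attitude game the attitudes are booleans: [true] is optimism and
    [false] is pessimism. *)
Definition attitudes (R : realType) (p : bool -> bool) : bool -> R :=
  fun i => (p i)%:R.

Definition rewards_well_defined (R : realType) (G : game R) : Prop :=
  forall p : bool -> bool,
    (exists! X, uncertainty_equilibrium G (attitudes R p) X) /\
    (forall X i t, uncertainty_equilibrium G (attitudes R p) X -> types G i t ->
       exists! x, attitude_responses G i (X (~~ i)) t (attitudes R p i) x).

(** The next three definitions are meaningful under [rewards_well_defined G]. *)
Definition equilibrium_sets (R : realType) (G : game R) (p : bool -> bool) :
    bool -> set R :=
  xget (fun=> set0) [set X | uncertainty_equilibrium G (attitudes R p) X].

Definition played_strategy (R : realType) (G : game R) (p : bool -> bool)
    (i : bool) (t : R) : R :=
  get (attitude_responses G i (equilibrium_sets G p (~~ i)) t (attitudes R p i)).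

Definition actual_reward (R : realType) (G : game R) (p : bool -> bool)
    (t : bool -> R) (i : bool) : R :=
  reward G i (played_strategy G p i (t i))
             (played_strategy G p (~~ i) (t (~~ i))) (t i).

Definition profile (T : Type) (i : bool) (own other : T) : bool -> T :=
  fun k => if k == i then own else other.

Definition dominant_attitude (R : realType) (G : game R) (i : bool) (ti : R)
    (p : bool) : Prop :=
  forall (q : bool) (tj : R), types G (~~ i) tj ->
  forall p' : bool,
    actual_reward G (profile i p' q) (profile i ti tj) i
      <= actual_reward G (profile i p q) (profile i ti tj) i.

Definition optimism : bool := true.
Definition pessimism : bool := false.

(* Main.v *)
Require Import Defs.
From HB Require Import structures.
From mathcomp Require Import all_boot all_order all_algebra.
From mathcomp Require Import all_classical all_reals all_analysis.
From mathcomp Require Import lra.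
Import Order.TTheory GRing.Theory Num.Theory.
Import numFieldNormedType.Exports.
Local Open Scope classical_set_scope.
Local Open Scope ring_scope.

(** By connectedness the reward moves in one direction in the opponent's strategy
    and best responses move in one direction in the type, for all values of the
    other arguments.  So an optimist best-responds to one endpoint of the belief
    set and a pessimist to the other, and an uncertainty equilibrium amounts to a
    pair of such endpoints, each being the best response of an extreme type to
    the other.

    Let the opponent be an optimist of the type [s] whose best responses are the
    most favourable ones for player [i].  If [i] is an optimist, she best-responds
    to the strategy that the opponent then plays; if she is a pessimist, she does
    not, as she expects the strategy of a different type.  So it is enough that
    her optimism does not make the opponent's strategy less favourable.  With [g]
    the best response of type [s], the conjectures of two optimists are a fixed
    point of [g \o g], and this fixed point is unique.  The conjecture of an
    optimist who faces a pessimist is moved by [g \o g] in the favourable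
    direction if [g] increases and in the other one if [g] decreases, so by the
    intermediate value theorem the fixed point lies on that side of it, and [g]
    carries this to the strategy that the opponent plays. *)

(** * Analytic preliminaries: continuity of maximizers, fixed points, signs, extrema *)

Lemma continuous_within_comp {T U V : topologicalType} (A : set T) (B : set U)
    (f : T -> U) (g : U -> V) :
  continuous f -> (forall x, A x -> B (f x)) ->
  {within B, continuous g} -> {within A, continuous (g \o f)}.
Proof.
move=> cf AB /subspace_continuousP cg; apply/subspace_continuousP => x Ax W Wgfx.
have := cg _ (AB _ Ax) _ Wgfx; rewrite /= !nbhs_simpl /within /= => H.
have := cf x _ H; rewrite nbhs_simpl /=.
by apply: filterS => z Hz Az; exact/Hz/AB.
Qed.

(** A point away from [b d0] is strictly beaten by [b d0] at [d0]. By continuity it is still beaten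
    at nearby parameters, and compactness of [K] makes the neighbourhood of [d0] uniform, so nearby
    maximizers stay close to [b d0]. *)
Lemma argmax_continuous {X D : topologicalType} {R : realType} (K : set X)
    (P : set D) (f : X * D -> R) (b : D -> X) :
  compact K -> {within K `*` P, continuous f} ->
  (forall d, P d -> K (b d)) ->
  (forall x d, K x -> P d -> x <> b d -> f (x, d) < f (b d, d)) ->
  {within P, continuous b}.
Proof.
move=> cK /subspace_continuousP cf Kb fb.
apply/subspace_continuousP => d0 Pd0 W.
rewrite nbhs_simpl nbhsE /= => -[A [oA Ab] AW].
rewrite nbhs_simpl /= /within /=.
have /compact_near_coveringP/near_covering_withinP cov := cK.
(* This is the uniform form that near coverings of [K] deliver: for [d] near [d0], no point of [K]
   outside [A] is [b d]. *)
suff : \forall d \near nbhs d0, K `<=` (fun x => P d -> x = b d -> A x).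
  by apply: filterS => d H Pd; apply: AW; apply: H => //; exact: Kb.
apply: cov => x Kx.
have [Ax|nAx] := pselect (A x).
  exists (A, setT) => /=; last by move=> [x' d'] [].
  by split; [exact: open_nbhs_nbhs|exact: filterT].
have lt0 : f (x, d0) < f (b d0, d0).
  by apply: fb => // xb; apply: nAx; rewrite xb.
(* The midpoint keeps the two values apart on whole neighbourhoods. *)
pose m := (f (x, d0) + f (b d0, d0)) / 2.
have /(cf (x, d0)) : nbhs (f (x, d0)) [set r | r < m].
  by apply: lt_nbhsl; rewrite /m; lra.
have /(cf (b d0, d0)) : nbhs (f (b d0, d0)) [set r | m < r].
  by apply: lt_nbhsr; rewrite /m; lra.
rewrite !nbhs_simpl /within /=.
move=> /(_ (conj (Kb _ Pd0) Pd0))[[B1 B2] /= [nB1 nB2] HB].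
move=> /(_ (conj Kx Pd0))[[C1 C2] /= [nC1 nC2] HC].
exists (C1, B2 `&` C2) => /=; first by split => //; exact: filterI.
move=> [x' d] /= [C1x [B2d C2d]] Kx' Pd xb.
have := HC (x', d) (conj C1x C2d) (conj Kx' Pd).
have := HB (b d0, d) (conj (nbhs_singleton nB1) B2d) (conj (Kb _ Pd0) Pd).
rewrite /= xb => h1 h2; have {h1 h2} h := lt_trans h2 h1.
have [e|ne] := pselect (b d0 = b d); first by move: h; rewrite e ltxx.
by have := lt_trans h (fb _ _ (Kb _ Pd0) Pd ne); rewrite ltxx.
Qed.

(** The function [F x - x] has opposite weak signs at [m] and at the endpoint on the wanted side,
    since [F] maps the interval to itself; its zero between them is the fixed point. *)
Lemma self_map_fixpoint {R : realType} (lo hi : R) (F : R -> R) (b : bool) (m : R) :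
  {within `[lo, hi], continuous F} ->
  (forall x, `[lo, hi]%classic x -> `[lo, hi]%classic (F x)) ->
  `[lo, hi]%classic m -> (if b then m <= F m else F m <= m) ->
  exists z, [/\ `[lo, hi]%classic z, F z = z & if b then m <= z else z <= m].
Proof.
move=> cF FS Sm mF.
have cd : {within `[lo, hi], continuous (fun x => F x - x)}.
  move=> x; apply: cvgB; first exact: cF.
  exact: (continuous_subspaceT (fun x => @cvg_id _ (nbhs x))).
move: (Sm); rewrite /= in_itv /= => /andP[lom mhi].
have lohi := le_trans lom mhi.
case: b mF => mF.
- have := FS hi; rewrite /= !in_itv /= lexx lohi => /(_ isT)/andP[_ Fhi].
  have [||c] := @IVT _ (fun x => F x - x) m hi 0 mhi.
  + by apply: continuous_subspaceW cd; apply: subset_itvr; rewrite bnd_simp.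
  + by rewrite le_max ge_min !subr_ge0 !subr_le0 mF Fhi orbT.
  + rewrite in_itv /= => /andP[mc chi] /subr0_eq Fc; exists c; split => //.
    by rewrite in_itv /= chi (le_trans lom).
- have := FS lo; rewrite /= !in_itv /= lexx lohi => /(_ isT)/andP[Flo _].
  have [||c] := @IVT _ (fun x => F x - x) lo m 0 lom.
  + by apply: continuous_subspaceW cd; apply: subset_itvl; rewrite bnd_simp.
  + by rewrite le_max ge_min !subr_ge0 !subr_le0 mF Flo orbT.
  + rewrite in_itv /= => /andP[loc cm] /subr0_eq Fc; exists c; split => //.
    by rewrite in_itv /= loc (le_trans cm).
Qed.

Lemma nonvanishing_constant_sign {R : realType} (a b : R) (f : R -> R) (x y : R) :
  {within `[a, b], continuous f} ->
  (forall z, `[a, b]%classic z -> f z != 0) ->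
  `[a, b]%classic x -> `[a, b]%classic y -> (0 < f x) = (0 < f y).
Proof.
move=> cf f0.
wlog xy : x y / x <= y => [H Sx Sy|Sx Sy].
  by have [xy|/ltW yx] := leP x y; [|symmetry]; exact: H.
have sub : `[x, y]%classic `<=` `[a, b]%classic.
  move: Sx Sy; rewrite /= !in_itv /= => /andP[ax _] /andP[_ yb].
  by apply: subset_itv; rewrite bnd_simp.
have cxy := continuous_subspaceW sub cf.
have H : ~ (Num.min (f x) (f y) <= 0 <= Num.max (f x) (f y)).
  move=> /(IVT xy cxy)[c cxy' fc]; have := f0 c (sub _ cxy').
  by rewrite fc eqxx.
move: (f0 _ Sx) (f0 _ Sy) H; rewrite ge_min le_max.
by case: ltgtP => // _ _; case: ltgtP.
Qed.

(** The boolean lets one argument cover rewards that increase and rewards that decrease in the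
    opponent's strategy. *)
Definition extremum {R : realType} (b : bool) (Y : set R) (y : R) : Prop :=
  Y y /\ forall z, Y z -> if b then z <= y else y <= z.

Lemma extremum_unique {R : realType} (b : bool) (Y : set R) (x y : R) :
  extremum b Y x -> extremum b Y y -> x = y.
Proof.
move=> [Yx xP] [Yy yP]; apply: le_anti.
by case: b xP yP => xP yP; rewrite xP ?yP.
Qed.

Lemma compact_extremum {R : realType} (b : bool) (Y : set R) :
  Y !=set0 -> compact Y -> exists y, extremum b Y y.
Proof.
move=> Y0 cY.
have cid : {within Y, continuous (fun x : R => x)}.
  exact: (continuous_subspaceT (fun x => @cvg_id _ (nbhs x))).
case: b; [have [c]:= compact_EVT_max Y0 cY cid|have [c]:= compact_EVT_min Y0 cY cid].
all: rewrite inE => Yc cP; exists c; split => // z Yz; apply: cP; exact: mem_set.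
Qed.

Lemma sup_extremum {R : realType} (Y : set R) (y : R) : extremum true Y y -> sup Y = y.
Proof.
move=> [Yy yP]; apply: le_anti; rewrite ge_sup//=; last by exists y.
by apply: ub_le_sup => //; exists y.
Qed.

Lemma inf_extremum {R : realType} (Y : set R) (y : R) : extremum false Y y -> inf Y = y.
Proof.
move=> [Yy yP]; apply: le_anti; apply/andP; split; first by apply: ge_inf => //; exists y.
by apply: lb_le_inf => //; exists y.
Qed.

Lemma eq_maximizers {R : realType} (D : set R) (f g : R -> R) :
  (forall x, D x -> f x = g x) -> maximizers D f = maximizers D g.
Proof.
move=> fg; apply/seteqP; split=> x [Dx xP]; split=> // z Dz.
  by rewrite -!fg//; exact: xP.
by rewrite !fg//; exact: xP.
Qed.

Lemma strictly_monotonic_inj {R : realType} (D : set R) (f : R -> R) (x y : R) :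
  strictly_monotonic_on D f -> D x -> D y -> f x = f y -> x = y.
Proof.
move=> mono /mem_set Dx /mem_set Dy fxy; apply: contrapT => /eqP; rewrite neq_lt.
case: mono => mono /orP[] lt.
- by have := mono _ _ Dx Dy lt; rewrite fxy ltxx.
- by have := mono _ _ Dy Dx lt; rewrite fxy ltxx.
- by have := mono _ _ Dy Dx lt; rewrite fxy ltxx.
- by have := mono _ _ Dx Dy lt; rewrite fxy ltxx.
Qed.

(** * Continuity and common directions of rewards and best responses *)

Section SymmetricGame.
Context (R : realType) (G : game R) (tlo thi : R).
Hypothesis hG : game_with_uncertainty G.
Hypothesis hsym : symmetric_game G.
Hypothesis hlen : tlo < thi.
Hypothesis htypes : forall i, types G i = `[tlo, thi]%classic.
Hypothesis hreward : forall i x t, strategies G i x -> types G i t ->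
  strictly_monotonic_on (strategies G (~~ i)) (fun y => reward G i x y t).
Hypothesis hresp_strat : forall i t, types G i t ->
  strictly_monotonic_on (strategies G (~~ i)) (fun y => best_response G i y t).
Hypothesis hresp_type : forall i y, strategies G (~~ i) y ->
  strictly_monotonic_on (types G i) (fun t => best_response G i y t).

Local Notation lo := (strat_lo G true).
Local Notation hi := (strat_hi G true).
Local Notation S := (strategies G true).
Local Notation T := `[tlo, thi]%classic.
Local Notation u := (reward G true).
Local Notation br := (best_response G true).

Lemma strategiesE i : strategies G i = S.
Proof. by case: i => //; rewrite (sym_strategies hsym). Qed.

Lemma rewardE i x y t : S x -> S y -> T t -> reward G i x y t = u x y t.
Proof. by case: i => // Sx Sy Tt; rewrite (sym_reward hsym)// htypes. Qed.

Lemma best_responses_symE i y t : S y -> T t ->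
  best_responses G i y t = best_responses G true y t.
Proof.
move=> Sy Tt; rewrite /best_responses strategiesE.
by apply: eq_maximizers => x Sx; exact: rewardE.
Qed.

Lemma best_responsesE i y t : S y -> T t -> best_responses G i y t = [set br y t].
Proof.
move=> Sy Tt; rewrite best_responses_symE//.
have Gy : strategies G (~~ true) y by rewrite strategiesE.
have Gt : types G true t by rewrite htypes.
have [x [xP xU]] := best_response_unique hG Gy Gt.
have brP : best_responses G true y t (br y t) by exact: (getI xP).
by apply/seteqP; split=> [z /xU <-|z ->//]; exact: xU.
Qed.

Lemma br_mem y t : S y -> T t -> S (br y t).
Proof.
move=> Sy Tt; have : best_responses G true y t (br y t) by rewrite best_responsesE.
by case.
Qed.

Lemma br_lt x y t : S x -> S y -> T t -> x <> br y t -> u x y t < u (br y t) y t.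
Proof.
move=> Sx Sy Tt xb; rewrite ltNge; apply/negP => le; apply: xb.
suff : best_responses G true y t x by rewrite best_responsesE.
split=> // z Sz; apply: le_trans le.
have : best_responses G true y t (br y t) by rewrite best_responsesE.
by case=> _; exact.
Qed.

Lemma br_le x y t : S x -> S y -> T t -> u x y t <= u (br y t) y t.
Proof.
by move=> Sx Sy Tt; have [->//|/br_lt h] := pselect (x = br y t); exact/ltW/h.
Qed.

Lemma reward_continuous_along {X : topologicalType} (A : set X) (f g h : X -> R) :
  continuous f -> continuous g -> continuous h ->
  (forall z, A z -> [/\ S (f z), S (g z) & T (h z)]) ->
  {within A, continuous (fun z => u (f z) (g z) (h z))}.
Proof.
move=> cf cg ch AP.
pose fgh z := (f z, g z, h z).
have cfgh : continuous fgh.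
  by move=> z; exact: (cvg_pair (cvg_pair (cf z) (cg z)) (ch z)).
apply: (continuous_within_comp _ _ _ _ cfgh _ (reward_continuous hG (i := true))).
by move=> z /AP[? ? ?]; rewrite htypes (strategiesE (~~ true)).
Qed.

Lemma compact_strategies : compact S.
Proof. exact: segment_compact. Qed.

Lemma br_continuous_along {X : topologicalType} (A : set X) (g h : X -> R) :
  continuous g -> continuous h -> (forall z, A z -> S (g z) /\ T (h z)) ->
  {within A, continuous (fun z => br (g z) (h z))}.
Proof.
move=> cg ch AP.
apply: (@argmax_continuous _ _ _ S _ (fun p => u p.1 (g p.2) (h p.2)) _
  compact_strategies).
- apply: reward_continuous_along => [z|z|z|[x z] /= [Sx /AP[]]//].
  + exact: cvg_fst.
  + by apply: (@cvg_comp _ _ _ snd g); [exact: cvg_snd|exact: cg].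
  + by apply: (@cvg_comp _ _ _ snd h); [exact: cvg_snd|exact: ch].
- by move=> z /AP[? ?]; exact: br_mem.
- by move=> x z Sx /AP[? ?]; exact: br_lt.
Qed.

(** The difference of the rewards at [hi] and [lo] is continuous and, by strict monotonicity, never
    zero, so its sign is the same for all own strategies and types. *)
Lemma reward_direction : exists d, forall x y z t, S x -> S y -> S z -> T t ->
  (if d then y <= z else z <= y) -> u x y t <= u x z t.
Proof.
pose f x t := u x hi t - u x lo t.
have Slohi : S lo /\ S hi.
  by rewrite /strategies /= !in_itv /= !lexx !(strat_le hG true).
have Tlo : T tlo by rewrite /= in_itv /= lexx ltW.
have mono x t : S x -> T t -> strictly_monotonic_on S (fun y => u x y t).
  move=> Sx Tt; have := @hreward true x t.
  by rewrite htypes (strategiesE (~~ true)); exact.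
(* If the strategy set is a single point, either direction will do. *)
have [lohi|hilo] := ltP lo hi; last first.
  exists true => x y z t _; rewrite /strategies /= !in_itv /=.
  move=> /andP[ly yh] /andP[lz zh] _ _; suff -> : y = z by [].
  apply: le_anti.
  by rewrite (le_trans yh (le_trans hilo lz)) (le_trans zh (le_trans hilo ly)).
have f0 x t : S x -> T t -> f x t != 0.
  move=> Sx Tt; rewrite subr_eq0; apply/eqP.
  move=> /(strictly_monotonic_inj _ _ _ _ (mono _ _ Sx Tt) Slohi.2 Slohi.1) hilo.
  by move: lohi; rewrite hilo ltxx.
have cid : continuous (@id R) by move=> z; exact: cvg_id.
have ccst (c : R) : continuous (fun _ : R => c) by move=> z; exact: cvg_cst.
have cfx t : T t -> {within `[lo, hi], continuous (f ^~ t)}.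
  move=> Tt; have [Slo Shi] := Slohi.
  have cy y : S y -> {within `[lo, hi], continuous (fun x => u x y t)}.
    move=> Sy; apply: (reward_continuous_along _ _ _ _ cid (ccst y) (ccst t)).
    by move=> x Sx; split; [exact: Sx|exact: Sy|exact: Tt].
  by move=> z; apply: cvgB; [exact: cy|exact: cy].
have cft : {within `[tlo, thi], continuous (f lo)}.
  have [Slo Shi] := Slohi.
  have cy y : S y -> {within `[tlo, thi], continuous (u lo y)}.
    move=> Sy; apply: (reward_continuous_along _ _ _ _ (ccst lo) (ccst y) cid).
    by move=> t Tt; split; [exact: Slo|exact: Sy|exact: Tt].
  by move=> z; apply: cvgB; [exact: cy|exact: cy].
(* Only one argument varies at a time: first [x] moves to [lo], then [t] moves to [tlo]. *)
have fS x t : S x -> T t -> (0 < f x t) = (0 < f lo tlo).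
  move=> Sx Tt; have [Slo _] := Slohi; transitivity (0 < f lo t).
    apply: (nonvanishing_constant_sign lo hi (f ^~ t) x lo) (cfx _ Tt) _ _ _ => //.
    by move=> z ?; exact: f0.
  by apply: (nonvanishing_constant_sign _ _ _ _ _ cft) => // z ?; exact: f0.
exists (0 < f lo tlo) => x y z t Sx Sy Sz Tt.
rewrite -(fS _ _ Sx Tt) subr_gt0.
have [->|/eqP yz] := pselect (y = z); first by [].
case: (mono _ _ Sx Tt) => H.
  have -> : u x lo t < u x hi t.
    by apply: H; rewrite ?inE; [exact: Slohi.1|exact: Slohi.2|].
  by move=> yz'; apply/ltW/H; rewrite ?inE// lt_neqAle yz.
have /lt_gtF -> : u x hi t < u x lo t.
  by apply: H; rewrite ?inE; [exact: Slohi.2|exact: Slohi.1|].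
by move=> yz'; apply/ltW/H; rewrite ?inE// lt_neqAle eq_sym yz.
Qed.


(** The same sign argument applies to the gap between the best responses of the two extreme types,
    which is continuous in the opponent's strategy. *)
Lemma type_direction : exists c, forall y s t, S y -> T s -> T t -> s < t ->
  if c then br y s < br y t else br y t < br y s.
Proof.
have Tlo : T tlo by rewrite /= in_itv /= lexx ltW.
have Thi : T thi by rewrite /= in_itv /= lexx ltW.
pose f y := br y thi - br y tlo.
have mono y : S y -> strictly_monotonic_on T (br y).
  by move=> Sy; have := @hresp_type true y; rewrite htypes (strategiesE (~~ true)); exact.
have f0 y : S y -> f y != 0.
  move=> Sy; rewrite subr_eq0; apply/eqP.
  move=> /(strictly_monotonic_inj _ _ _ _ (mono _ Sy) Thi Tlo) hilo.
  by move: hlen; rewrite hilo ltxx.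
have cf : {within `[lo, hi], continuous f}.
  have ct t : T t -> {within `[lo, hi], continuous (br ^~ t)}.
    move=> Tt; apply: (br_continuous_along _ id (fun _ : R => t)) => z.
    + exact: cvg_id.
    + exact: cvg_cst.
    + by [].
  by move=> z; apply: cvgB; [exact: ct|exact: ct].
have Slo : S lo by rewrite /strategies /= in_itv /= lexx (strat_le hG true).
exists (0 < f lo) => y s t Sy Ts Tt st.
rewrite (nonvanishing_constant_sign _ _ _ _ _ cf f0 Slo Sy) subr_gt0.
case: (mono _ Sy) => H.
  have -> : br y tlo < br y thi by apply: H; rewrite ?inE.
  by apply: H; rewrite ?inE.
have /lt_gtF -> : br y thi < br y tlo by apply: H; rewrite ?inE.
by apply: H; rewrite ?inE.
Qed.

(** * Uncertainty equilibria as pairs of conjectures *)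

Section Directions.
Variables d c : bool.
Hypothesis reward_mono : forall x y z t, S x -> S y -> S z -> T t ->
  (if d then y <= z else z <= y) -> u x y t <= u x z t.
Hypothesis br_type_mono : forall y s t, S y -> T s -> T t -> s < t ->
  if c then br y s < br y t else br y t < br y s.

(* The type whose best responses are the largest ones if [b], else the smallest. *)
Definition extreme_type (b : bool) : R := if b == c then thi else tlo.
Local Notation s := extreme_type.

Lemma extreme_type_mem b : T (s b).
Proof. by rewrite /extreme_type; case: ifP => _; rewrite /= in_itv /= lexx ltW. Qed.

Lemma br_type_inj y t t' : S y -> T t -> T t' -> br y t = br y t' -> t = t'.
Proof.
move=> Sy Tt Tt' e; case: (ltgtP t t') => // /br_type_mono.
  by move=> /(_ _ Sy Tt Tt'); rewrite e; case: ifP; rewrite ltxx.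
by move=> /(_ _ Sy Tt' Tt); rewrite e; case: ifP; rewrite ltxx.
Qed.

Lemma extremum_br b y : S y -> extremum b (br y @` T) (br y (s b)).
Proof.
move=> Sy; split; first by exists (s b) => //; exact: extreme_type_mem.
have Tlo := extreme_type_mem (~~ c); have Thi := extreme_type_mem c.
move: Tlo Thi; rewrite /extreme_type eqxx; have -> : (~~ c == c) = false by case: c.
move=> Tlo Thi _ [t Tt <-].
have /andP[lot thit] : tlo <= t <= thi by move: Tt; rewrite /= in_itv.
have H1 : if c then br y tlo <= br y t else br y t <= br y tlo.
  move: lot; rewrite le_eqVlt => /predU1P[->|]; first by case: ifP.
  by move=> /br_type_mono -/(_ _ Sy Tlo Tt); case: ifP => _ /ltW.
have H2 : if c then br y t <= br y thi else br y thi <= br y t.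
  move: thit; rewrite le_eqVlt => /predU1P[->|]; first by case: ifP.
  by move=> /br_type_mono -/(_ _ Sy Tt Thi); case: ifP => _ /ltW.
by case: b; move: H1 H2; case: c.
Qed.

(* [p == d] tells whether attitude [p] looks at the maximum of the belief set. *)
Lemma attitude_value_extremum i p x Y t e : Y `<=` S -> S x -> T t ->
  extremum (p == d) Y e -> attitude_value G i x Y t p%:R = u x e t.
Proof.
move=> YS Sx Tt [Ye eP].
(* Here [q] selects the largest or smallest reward, whereas [p == d] selects an end of [Y]; the
   direction [d] translates between the two. *)
have im q : (if q then forall y, Y y -> u x y t <= u x e t
                  else forall y, Y y -> u x e t <= u x y t) ->
    extremum q [set reward G i x y t | y in Y] (u x e t).
  move=> H; split; first by exists e => //; rewrite rewardE//; exact: YS.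
  move=> _ [y Yy <-]; rewrite rewardE//; last exact: YS.
  by case: q H; exact.
rewrite /attitude_value; case: p eP => eP.
  rewrite (sup_extremum _ _ (im true _)) ?mul1r ?subrr ?mul0r ?addr0//.
  move=> y Yy; apply: reward_mono => //; [exact: YS|exact: YS|].
  by move: (eP _ Yy); case: (d).
rewrite (inf_extremum _ _ (im false _)) ?mul0r ?subr0 ?mul1r ?add0r//.
move=> y Yy; apply: reward_mono => //; [exact: YS|exact: YS|].
by move: (eP _ Yy); case: (d).
Qed.

Lemma attitude_responsesE i p Y t e : Y `<=` S -> T t -> extremum (p == d) Y e ->
  attitude_responses G i Y t p%:R = [set br e t].
Proof.
move=> YS Tt eP; have Se : S e by apply: YS; case: eP.
rewrite -(best_responsesE i)// /attitude_responses /best_responses strategiesE.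
by apply: eq_maximizers => x Sx; rewrite (attitude_value_extremum _ _ _ _ _ e)// rewardE.
Qed.

Lemma psiE i p Y e : Y `<=` S -> extremum (p == d) Y e -> psi G i Y p%:R = br e @` T.
Proof.
move=> YS eP; apply/seteqP; rewrite /psi htypes; split=> [x [t Tt]|_ [t Tt <-]].
  by rewrite (attitude_responsesE _ _ _ _ e)// => ->; exists t.
by exists t => //; rewrite (attitude_responsesE _ _ _ _ e).
Qed.

(* [e i] is the point of the belief set [X (~~ i)] that player [i] responds to. *)
Definition conjectures (p : bool -> bool) (e : bool -> R) : Prop :=
  forall i, S (e i) /\ e i = br (e (~~ i)) (s (p i == d)).

(** Each belief set is the image of all types under the best response to one point. Its extremum is
    therefore the response of an extreme type, and uniqueness of extrema gives the equations for
    [e]. *)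
Lemma equilibrium_conjectures p X : uncertainty_equilibrium G (attitudes R p) X ->
  exists e, [/\ conjectures p e, forall i, X i = br (e i) @` T &
    forall i, X (~~ i) `<=` S /\ extremum (p i == d) (X (~~ i)) (e i)].
Proof.
move=> XE.
have XS i : X i `<=` S.
  have [_ _ ->] := XE i; rewrite -(strategiesE i).
  by move=> x [t _ []].
have /choice[e eP] : forall i, exists y, extremum (p i == d) (X (~~ i)) y.
  by move=> i; have [? ? _] := XE (~~ i); exact: compact_extremum.
have Xe i : X i = br (e i) @` T.
  by have [_ _ ->] := XE i; rewrite /attitudes (psiE _ _ _ (e i)).
exists e; split=> // i; have Se k : S (e k) by apply: (XS (~~ k)); case: (eP k).
split=> //; apply: extremum_unique (eP i) _.
by rewrite Xe; exact: extremum_br.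
Qed.

Lemma conjectures_equilibrium p e : conjectures p e ->
  uncertainty_equilibrium G (attitudes R p) (fun i => br (e i) @` T).
Proof.
move=> eP i; have [Se _] := eP i; have [Sne _] := eP (~~ i); split.
- by exists (br (e i) (s true)); exists (s true) => //; exact: extreme_type_mem.
- apply: continuous_compact (@segment_compact _ _ _).
  apply: (br_continuous_along _ (fun _ : R => e i) id) => z.
  + exact: cvg_cst.
  + exact: cvg_id.
  + by [].
- rewrite /attitudes (psiE _ _ _ (e i))//.
  + by move=> _ [t Tt <-]; exact: br_mem.
  + by have [_ ->] := eP i; exact: extremum_br.
Qed.

Hypothesis hwd : rewards_well_defined G.

(** Both families generate the same equilibrium sets, and a conjecture can be recovered from them as
    an extremum. *)
Lemma conjectures_unique p e e' : conjectures p e -> conjectures p e' -> e = e'.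
Proof.
move=> eP e'P; have [[X [XE XU]] _] := hwd p.
have XX := XU _ (conjectures_equilibrium _ _ eP).
have := XU _ (conjectures_equilibrium _ _ e'P); rewrite XX => {}XX.
apply/funext => i; have [_ ei] := eP i; have [_ e'i] := e'P i.
have [Se _] := eP (~~ i); have [Se' _] := e'P (~~ i).
have := extremum_br (p i == d) _ Se; rewrite -ei => h1.
have := extremum_br (p i == d) _ Se'; rewrite -e'i => h2.
by apply: extremum_unique h1 _; have /(congr1 (@^~ (~~ i))) /= -> := XX.
Qed.

Lemma conjectures_exist p : exists e, conjectures p e /\
  forall i t, T t -> played_strategy G p i t = br (e i) t.
Proof.
have [[X [XE XU]] _] := hwd p.
have eqX : equilibrium_sets G p = X.
  by apply/esym/XU; exact: (xgetI (fun=> set0) XE).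
have [e [eP _ XeP]] := equilibrium_conjectures _ _ XE.
exists e; split=> // i t Tt; have [XS ext] := XeP i.
rewrite /played_strategy eqX (attitude_responsesE _ _ _ _ (e i))//.
by have := @getI _ [set br (e i) t] (br (e i) t); exact.
Qed.

(** * Comparison of optimism with pessimism *)

Lemma optimism_raises_opponent i p p' e e' :
  (forall k, p k = true) -> p' (~~ i) = true ->
  conjectures p e -> conjectures p' e' ->
  if d then br (e' (~~ i)) (s d) <= e i else e i <= br (e' (~~ i)) (s d).
Proof.
move=> p1 p'1 eP e'P; set w := br _ _ => /=.
have sE : (true == d) = d by case: (d).
pose g y := br y (s d).
have gS y : S y -> S (g y) by move=> Sy; apply: br_mem => //; exact: extreme_type_mem.
set z' := e' (~~ i); have [Sz' z'E] := e'P (~~ i); have [Sx' x'E] := e'P i.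
rewrite p'1 sE negbK -/(g _) -/z' in z'E Sz'; rewrite -/z' in x'E.
(* The conjecture [e' i] is the response to [z'] of some extreme type, and [g z'] is the most
   favourable of all responses to [z']. *)
have x'g : if d then e' i <= g z' else g z' <= e' i.
  have [_ h] := extremum_br d _ Sz'; apply: (h (e' i)).
  by rewrite x'E; exists (s (p' i == d)) => //; exact: extreme_type_mem.
have cg : {within `[lo, hi], continuous g}.
  apply: (br_continuous_along _ id (fun _ : R => s d)) => z.
  - exact: cvg_id.
  - exact: cvg_cst.
  - by move=> Sz; split => //; exact: extreme_type_mem.
have cgg : {within `[lo, hi], continuous (g \o g)}.
  apply/subspace_continuousP => y Sy; have Sgy := gS _ Sy.
  move/subspace_continuousP: cg => cg W Wg.
  have := cg _ Sgy _ Wg; rewrite !nbhs_simpl /= /within /= => H.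
  have := cg _ Sy _ H; rewrite !nbhs_simpl /within /=.
  by apply: filterS => z Hz Sz; apply: Hz => //; exact: gS.
(* A fixed point [z] of [g \o g] yields the conjectures [g z] and [z] of two optimists, so
   uniqueness identifies [g z] with [e i]. *)
have fix_e z : S z -> g (g z) = z -> e i = g z.
  move=> Sz ggz.
  have /(conjectures_unique _ _ _ eP) -> : conjectures p (profile i (g z) z).
    move=> k; rewrite p1 sE /profile; case: (i); case: k => /=; split => //; exact: gS.
  by rewrite /profile eqxx.
have mono : strictly_monotonic_on S g.
  have := @hresp_strat true (s d); rewrite htypes (strategiesE (~~ true)).
  by apply; exact: extreme_type_mem.
have ggS y : S y -> S ((g \o g) y) by move=> Sy; exact/gS/gS.
case: mono => mono.
- have gle x y : S x -> S y -> x <= y -> g x <= g y.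
    move=> Sx Sy; rewrite le_eqVlt => /predU1P[->//|xy].
    by apply/ltW/mono; rewrite ?inE.
  have [|z [Sz ggz z'z]] :=
    self_map_fixpoint lo hi (g \o g) d z' cgg ggS Sz'.
    (* Since [z'] is [g (e' i)], comparing it with [g (g z')] reduces to comparing [e' i] with
       [g z']. *)
    by rewrite {1 4}z'E /=; case: (d) x'g => x'g; apply: gle => //; exact: gS.
  rewrite (fix_e z Sz ggz) (_ : w = g z')//.
  by case: (d) z'z => z'z; exact: gle.
- have gge x y : S x -> S y -> x <= y -> g y <= g x.
    move=> Sx Sy; rewrite le_eqVlt => /predU1P[->//|xy].
    by apply/ltW/mono; rewrite ?inE.
  (* A decreasing [g] reverses [x'g], so the fixed point is sought on the other side of [z'];
     applying [g] once more restores the direction. *)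
  have [|z [Sz ggz z'z]] :=
    self_map_fixpoint lo hi (g \o g) (~~ d) z' cgg ggS Sz'.
    by rewrite {1 4}z'E /=; case: (d) x'g => x'g; apply: gge => //; exact: gS.
  rewrite (fix_e z Sz ggz) (_ : w = g z')//.
  by case: (d) z'z => z'z; exact: gge.
Qed.

Lemma pessimism_not_dominant i ti : T ti -> ~ dominant_attitude G i ti pessimism.
Proof.
move=> Tti dom.
have sE : (true == d) = d by case: (d).
have [e [eP eplay]] := conjectures_exist (profile i true true).
have [e' [e'P e'play]] := conjectures_exist (profile i false true).
have Tsd := extreme_type_mem d.
have ni : (~~ i == i) = false by case: (i).
have w_le : if d then br (e' (~~ i)) (s d) <= e i else e i <= br (e' (~~ i)) (s d).
  apply: optimism_raises_opponent eP e'P.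
    by move=> k; rewrite /profile; case: ifP.
  by rewrite /profile ni.
have [Sei eiE] := eP i; have [Se'j _] := e'P (~~ i); have [Se'i e'iE] := e'P i.
rewrite /profile eqxx sE in eiE; rewrite /profile eqxx in e'iE.
set w := br (e' (~~ i)) (s d) in w_le.
have Sw : S w by exact: br_mem.
have [Sej ejE] := eP (~~ i); rewrite /profile ni sE negbK in ejE.
have := dom true (s d); rewrite htypes => /(_ Tsd true).
rewrite /actual_reward !eplay ?e'play /pessimism /profile ?eqxx ?ni//.
rewrite !rewardE//; try exact: br_mem.
rewrite -/w -eiE; apply/negP; rewrite -ltNge.
(* The pessimist expects the response to [e' (~~ i)] of one extreme type, while [w] is that of the
   other. *)
have e'i_neq : e' i <> w.
  rewrite e'iE => /(br_type_inj _ _ _ Se'j (extreme_type_mem _) Tsd).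
  by move: hlen; rewrite /extreme_type; case: (d); case: (c) => /= + h; rewrite h ltxx.
have br_neq : br (e' i) ti <> br w ti.
  have mono : strictly_monotonic_on S (br ^~ ti).
    by have := @hresp_strat true ti; rewrite htypes (strategiesE (~~ true)); exact.
  by move=> /(strictly_monotonic_inj _ _ _ _ mono Se'i Sw).
(* Against [w], the pessimist gains strictly by responding to [w]; she then gains weakly when the
   opponent moves from [w] to [e i], and again by responding to [e i], which is the optimist's
   outcome. *)
apply: (@lt_le_trans _ _ (u (br w ti) w ti)).
  by apply: br_lt => //; exact: br_mem.
apply: (@le_trans _ _ (u (br w ti) (e i) ti)).
  by apply: reward_mono => //; exact: br_mem.
by apply: br_le => //; exact: br_mem.
Qed.

End Directions.
End SymmetricGame.

Theorem theorem8 (R : realType) (G : game R) (tlo thi : R)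
  (hG : game_with_uncertainty G)
  (hsym : symmetric_game G)
  (hlen : tlo < thi)
  (htypes : forall i, types G i = `[tlo, thi]%classic)
  (hreward : forall i x t, strategies G i x -> types G i t ->
     strictly_monotonic_on (strategies G (~~ i)) (fun y => reward G i x y t))
  (hresp_strat : forall i t, types G i t ->
     strictly_monotonic_on (strategies G (~~ i)) (fun y => best_response G i y t))
  (hresp_type : forall i y, strategies G (~~ i) y ->
     strictly_monotonic_on (types G i) (fun t => best_response G i y t))
  (hwd : rewards_well_defined G) :
  forall (i : bool) (ti : R), types G i ti ->
    ~ dominant_attitude G i ti pessimism.
Proof.
move=> i ti; rewrite htypes => Tti.
have [d hd] := reward_direction _ _ _ _ hG hsym hlen htypes hreward.
have [c hc] := type_direction _ _ _ _ hG hsym hlen htypes hresp_type.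
by apply: (pessimism_not_dominant _ _ tlo thi _ _ _ _ _ d c).
Qed.
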